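(* Let $\mathcal H$ be a Hilbert space and let $\{f_k\}_{k=1}^\infty$ and $\{g_k\}_{k=1}^\infty$ be sequences in $\mathcal H$ such that $f=\sum_{k=1}^\infty\langle f,g_k\rangle f_k$ for every $f\in\mathcal H$. Assume that $\sum_{k=1}^\infty\langle f,g_k\rangle f_{k+1}$ converges for every $f\in\mathcal H$. Then $\{f_k\}_{k=1}^\infty$ can be represented as $\{T^nf_1\}_{n=0}^\infty$ (that is, $f_{k+1}=Tf_k$ for all $k\in\mathbb N$) for some bounded linear operator $T:\mathcal H\to\mathcal H$ if and only if $$f_{j+1}=\sum_{k=1}^\infty\langle f_j,g_k\rangle f_{k+1}\quad\text{for all } j\in\mathbb N.$$
   Context: All series are understood to converge in the norm of $\mathcal H$ (with the given ordering of the index set $\mathbb N=\{1,2,\dots\}$). No frame or Bessel condition is assumed on $\{f_k\}_{k=1}^\infty$ or $\{g_k\}_{k=1}^\infty$. *)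

(* Defs.v *)
From HB Require Import structures.
From mathcomp Require Import all_boot all_order all_algebra sesquilinear.
From mathcomp Require Import complex.
From mathcomp Require Import all_classical all_reals all_analysis.

Set Implicit Arguments.
Unset Strict Implicit.
Unset Printing Implicit Defensive.

Import Order.TTheory GRing.Theory Num.Theory.
Import numFieldNormedType.Exports.

Local Open Scope ring_scope.
Local Open Scope classical_set_scope.

(* Hilbert spaces may be real or complex: the scalar field over a model R of
   the real numbers is R itself or R[i]. *)
Variant scalar_kind := RealScalars | ComplexScalars.

Definition scalars (R : realType) (s : scalar_kind) : numFieldType :=
  match s with
  | RealScalars => R
  | ComplexScalars => R[i]%C
  end.

Definition sconj (R : realType) (s : scalar_kind) :
    scalars R s -> scalars R s :=
  match s with
  | RealScalars => fun x : R => x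
  | ComplexScalars => fun z : R[i]%C => conjc z
  end.

(* The norm of H is the one induced by the inner product, so that a complete H
   is a Hilbert space. {dot H for sconj} is linear in its first argument and
   conjugate-linear in its second. *)
Definition norm_induced (R : realType) (s : scalar_kind)
    (H : normedModType (scalars R s)) (dot : {dot H for @sconj R s}) : Prop :=
  forall x : H, `|x| ^+ 2 = dot x x.

Definition bounded_operator (K : numFieldType) (V W : normedModType K)
    (T : V -> W) : Prop :=
  exists M : K, forall x : V, `|T x| <= M * `|x|.

(* Sequences indexed by {1, 2, ...} are shifted to start at 0: [f k] is the
   (k+1)-st vector f_(k+1). *)
Definition orbit_of (V : Type) (f : nat -> V) (T : V -> V) : Prop :=
  forall n : nat, f n = iter n T (f 0%N).

(* Main.v *)
(* If the series of <x, g_k> f_(k+1) converges for every x, its sum defines a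
   linear operator, the pointwise limit of the partial sums. Each partial sum is
   continuous by Cauchy-Schwarz, so the uniform boundedness principle makes the
   limit T bounded, and the stated identity at x = f_j reads T f_j = f_(j+1).
   Conversely, a bounded T with T f_k = f_(k+1) can be applied termwise to the
   expansion of f_j. *)

Require Import Defs.
From HB Require Import structures.
From mathcomp Require Import all_boot all_order all_algebra sesquilinear.
From mathcomp Require Import complex.
From mathcomp Require Import all_classical all_reals all_analysis.
Import Order.TTheory GRing.Theory Num.Theory.
Import numFieldNormedType.Exports.
Local Open Scope ring_scope.
Local Open Scope classical_set_scope.

(** * Uniform boundedness over real or complex scalars, by nested balls *)

Lemma linear_bound_of_ball (K : numFieldType) (V W : normedModType K)
    (T : {linear V -> W}) (y : V) (r M : K) :
    0 < r -> (forall z, `|y - z| <= r -> `|T z| <= M) ->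
  forall x, `|T x| <= (M + M) / r * `|x|.
Proof.
move=> r0 TM x; have [->|x0] := eqVneq x 0; first by rewrite raddf0 !normr0 mulr0.
have nx0 : 0 < `|x| by rewrite normr_gt0.
have Ty : `|T y| <= M by apply: TM; rewrite subrr normr0 ltW.
(* The multiple of [x] of norm [r] is a difference of two points of the ball, so its image has norm
   at most [M + M]. *)
have Tz : `|T (y + (r / `|x|) *: x)| <= M.
  apply: TM; rewrite opprD addNKr normrN normrZ gtr0_norm ?divr_gt0//.
  by rewrite divfK ?gt_eqF.
have : `|(r / `|x|) *: T x| <= M + M.
  rewrite -linearZ -[X in T X](addKr y) addrC linearB.
  by rewrite (le_trans (ler_normB _ _))// lerD.
by rewrite normrZ gtr0_norm ?divr_gt0// mulrAC ler_pdivrMr// mulrC -ler_pdivlMr// mulrAC.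
Qed.

(** The shrinking step of the nested-balls argument: by continuity, a strict lower bound at [z]
    persists on a small closed ball around [z]. *)
Lemma ball_bounded_below (K : numFieldType) (V W : normedModType K)
    (T : {linear V -> W}) (y z : V) (r s c : K) :
    continuous T -> 0 < s -> `|y - z| < r -> c < `|T z| ->
  exists q : {posnum K}, [/\ `|y - z| + q%:num <= r, q%:num <= s &
    forall w, `|z - w| <= q%:num -> c < `|T w|].
Proof.
move=> contT s0 yz cT.
have Tc0 : 0 < `|T z| - c by rewrite subr_gt0.
have /cvgrPdist_lt/(_ _ Tc0)/nbhs_normP[d /= d0 dT] := contT z.
have yz0 : 0 < r - `|y - z| by rewrite subr_gt0.
near (0 : K)^'+ => q.
have q0 : 0 < q by [].
exists (PosNum q0) => /=; split.
- by rewrite -lerBrDl; near: q; exact: nbhs_right_le.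
- by near: q; exact: nbhs_right_le.
- move=> w zw; have /dT : `|z - w| < d.
    by rewrite (le_lt_trans zw)//; near: q; exact: nbhs_right_lt.
  rewrite /= ltrBrDl -ltrBrDr => /lt_le_trans; apply.
  by rewrite lerBlDr -{1}[T z](subrKC (T w)) ler_normD.
Unshelve. all: by end_near. Qed.

Lemma cvg_norm_le (K : numFieldType) (V : normedModType K) (u : nat -> V)
    (l : V) (M : K) :
  (\forall n \near \oo, `|u n| <= M) -> u @ \oo --> l -> `|l| <= M.
Proof.
move=> uM ul.
have [n Mn] : exists n, `|u n| <= M.
  by case: uM => N _ uM; exists N; exact: uM (leqnn N).
(* The order of [K] may be partial, so [M] must be comparable with norms before arguing by
   contradiction. *)
have Mreal : M \is Num.real by rewrite realE (le_trans _ Mn).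
rewrite real_leNgt ?normr_real//; apply/negP; rewrite -subr_gt0 => lM.
move/cvgrPdist_lt: ul => /(_ _ lM) ul.
have [m [um]] : exists m, `|u m| <= M /\ `|l - u m| < `|l| - M.
  by near \oo => m; exists m; split; near: m.
rewrite ltrBrDr => /(le_lt_trans (lerD (lexx _) um)).
by rewrite -{2}[l](subrK (u m)) => /le_lt_trans-/(_ _ (ler_normD _ _)); rewrite ltxx.
Unshelve. all: by end_near. Qed.

(** Each closed ball contains the next and the radii tend to 0, so the centres form a Cauchy
    sequence; its limit stays in every closed ball. *)
Lemma nested_balls (K : numFieldType) (V : completeNormedModType K)
    (a : nat -> V) (r : nat -> K) :
    Num.archimedean_axiom K ->
    (forall n, `|a n - a n.+1| + r n.+1 <= r n) ->
    (forall n, 0 < r n <= n.+1%:R^-1) ->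
  exists l, forall n, `|a n - l| <= r n.
Proof.
move=> archi nest rle.
have dist n m : (n <= m)%N -> `|a n - a m| + r m <= r n.
  elim: m => [|m IH]; first by rewrite leqn0 => /eqP ->; rewrite subrr normr0 add0r.
  rewrite leq_eqVlt => /orP[/eqP ->|/IH]; first by rewrite subrr normr0 add0r.
  apply: le_trans; have := ler_normD (a n - a m) (a m - a m.+1).
  rewrite subrKA => /lerD/(_ (lexx (r m.+1)))/le_trans; apply.
  by rewrite -addrA lerD.
have dist_le n m : (n <= m)%N -> `|a n - a m| <= r n.
  move/dist; apply: le_trans; rewrite lerDl ltW//.
  by have /andP[] := rle m.
have /cvg_ex[l al] : cvg (a @ \oo).
  apply: cauchy_cvg; apply: cauchy_exP => e e0.
  have [n ne] := archi e^-1.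
  exists (a n), n => // m /= nm; rewrite -ball_normE /=.
  apply: le_lt_trans (dist_le _ _ nm) _.
  have /andP[_ /le_lt_trans] := rle n; apply.
  rewrite -[e]invrK ltf_pV2 ?posrE ?invr_gt0//.
  by move: ne; rewrite gtr0_norm ?invr_gt0// => /lt_le_trans; apply; rewrite ler_nat.
exists l => n.
have : (fun m => a n - a m) @ \oo --> a n - l by apply: cvgB => //; exact: cvg_cst.
apply: cvg_norm_le; exists n => // m; exact: dist_le.
Qed.

(* The library's Banach-Steinhaus theorem assumes real scalars; this version
   also covers complex ones. *)
Lemma uniform_boundedness (K : numFieldType) (V : completeNormedModType K)
    (W : normedModType K) (I : Type) (S : I -> {linear V -> W}) :
    Num.archimedean_axiom K -> (forall i, continuous (S i)) ->
    (forall x, exists M, forall i, `|S i x| <= M) ->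
  exists M, forall i x, `|S i x| <= M * `|x|.
Proof.
move=> archi contS bndS; apply: contrapT => noM.
have step (np : nat * (V * {posnum K})) : exists q : V * {posnum K},
    [/\ `|np.2.1 - q.1| + q.2%:num <= np.2.2%:num,
        q.2%:num <= np.1.+2%:R^-1 &
        exists i, forall z, `|q.1 - z| <= q.2%:num -> np.1%:R < `|S i z|].
  case: np => n [y r] /=.
  (* Otherwise all [S i] are bounded by [n] on the half-radius ball, which gives the uniform bound
     excluded by [noM]. Halving keeps [z] strictly inside the old ball. *)
  have [i [z yz Sz]] : exists i, exists2 z, `|y - z| <= r%:num / 2 & n%:R < `|S i z|.
    apply: contrapT => small; apply: noM.
    exists ((n%:R + n%:R) / (r%:num / 2)) => i x.
    apply: (@linear_bound_of_ball _ _ _ _ y); first by rewrite divr_gt0.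
    move=> z yz.
    rewrite real_leNgt ?normr_real ?realn//; apply/negP => Sz.
    by apply: small; exists i, z.
  have yzr : `|y - z| < r%:num by rewrite (le_lt_trans yz)// gtr_pMr// invf_lt1// ltr1n.
  have n2 : (0 : K) < n.+2%:R^-1 by rewrite invr_gt0.
  have [q [? ? ?]] := ball_bounded_below _ _ _ _ _ _ _ _ _ (contS i) n2 yzr Sz.
  by exists (z, q); split => //; exists i.
have [next nextP] := choice step.
(* Starting from the unit ball, ball [n] has radius at most [n.+1%:R^-1], and on ball [n.+1] some
   [S i] exceeds [n]. *)
pose fix p n := if n is m.+1 then next (m, p m) else (0 : V, PosNum (@ltr01 K)).
have [l Hl] : exists l, forall n, `|(p n).1 - l| <= (p n).2%:num.
  apply: (@nested_balls _ _ (fun n => (p n).1) (fun n => (p n).2%:num)) => // [n|[|n]] /=.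
  - by have [] := nextP (n, p n).
  - by rewrite invr1 ltr01 lexx.
  - by have [_ -> _] := nextP (n, p n); rewrite andbT.
(* The common point [l] contradicts the pointwise bound once [n] exceeds [M]. *)
have [M SM] := bndS l.
have [n Mn] := archi M.
have [_ _ [i Si]] := nextP (n, p n).
have := lt_le_trans (Si _ (Hl n.+1)) (SM i).
move=> /= nM.
by move: Mn; rewrite ger0_norm ?(le_trans _ (ltW nM))// => /(lt_trans nM); rewrite ltxx.
Qed.

Lemma bounded_operator_continuous (K : numFieldType) (V W : normedModType K)
    (T : {linear V -> W}) :
  bounded_operator T -> continuous T.
Proof.
move=> [M TM]; apply: bounded_linear_continuous; apply/bounded_funP => r.
(* No sign is assumed for [M], but [M * |x|] dominates a norm, hence equals [|M| * |x|]. *)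
exists (`|M| * r) => x xr; rewrite (le_trans (TM x))//.
have Mx0 : 0 <= M * `|x| by rewrite (le_trans _ (TM x)).
by rewrite -(ger0_norm Mx0) normrM normr_id ler_wpM2l.
Qed.

(** Convergent sequences are bounded, so uniform boundedness gives one constant for all [S n], and
    it survives in the limit. *)
Lemma pointwise_limit_bounded_operator (K : numFieldType)
    (V : completeNormedModType K) (W : normedModType K)
    (S : nat -> {linear V -> W}) :
    Num.archimedean_axiom K -> (forall n, continuous (S n)) ->
    (forall x, cvg (S n x @[n --> \oo])) ->
  exists2 T : {linear V -> W}, bounded_operator T &
    forall x, S n x @[n --> \oo] --> T x.
Proof.
move=> archi contS cvgS; pose T x := lim (S n x @[n --> \oo]).
have Tlin : linear T.
  move=> a x y; apply: cvg_lim => //.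
  under eq_fun do rewrite linearP.
  by apply: cvgD (cvgS y); apply: cvgZl_tmp (cvgS x).
pose Tl : {linear V -> W} := HB.pack T (GRing.isLinear.Build _ _ _ _ T Tlin).
exists Tl => [|x]; last exact: cvgS.
have [x|M SM] := uniform_boundedness _ _ _ _ S archi contS.
  by have /pinfty_ex_gt0[M _ SM] := cvg_seq_bounded (cvgS x); exists M => n; exact: SM.
by exists M => x; apply: cvg_norm_le (cvgS x); exact: nearW.
Qed.

Lemma scalars_archimedean (R : realType) (s : scalar_kind) :
  Num.archimedean_axiom (scalars R s).
Proof.
case: s => x /=; first by exists (Num.bound `|x|); exact: archi_boundP.
exists (Num.bound (complex.Re `|x|)).
rewrite -[`|x|]RRe_real ?normr_real// -(rmorph_nat (real_complex R)) ltcR.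
by rewrite archi_boundP// -ler0c RRe_real ?normr_real.
Qed.

Lemma sqr_norm_sconj (R : realType) (s : scalar_kind) (a : scalars R s) :
  a * sconj a = `|a| ^+ 2.
Proof. by case: s a => a /=; [rewrite real_normK ?num_real | rewrite sqr_normc]. Qed.

Lemma sconj0 (R : realType) (s : scalar_kind) : @sconj R s 0 = 0.
Proof. by case: s; [|exact: conjc0]. Qed.

(** * Cauchy-Schwarz and the partial sums of the expansion *)

Section InnerProduct.
Context {R : realType} {s : scalar_kind} {H : normedModType (scalars R s)}.
Variable dot : {dot H for @sconj R s}.
Hypothesis Hnorm : norm_induced dot.

Lemma dot_sym (x y : H) : dot x y = sconj (dot y x).
Proof. by rewrite (@hermitian_subproof _ _ _ _ dot) expr0 mul1r. Qed.

Lemma dotDl (x y z : H) : dot (x + y) z = dot x z + dot y z.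
Proof. exact: linearDl. Qed.

Lemma dotDr (x y z : H) : dot x (y + z) = dot x y + dot x z.
Proof. exact: linearDr. Qed.

Lemma dotZl (a : scalars R s) (x y : H) : dot (a *: x) y = a * dot x y.
Proof. exact: linearZl_LR. Qed.

Lemma dotZr (a : scalars R s) (x y : H) : dot x (a *: y) = sconj a * dot x y.
Proof. exact: linearZr_LR. Qed.

Lemma pythagoras (u v : H) (a : scalars R s) : dot u v = 0 ->
  dot (u + a *: v) (u + a *: v) = dot u u + `|a| ^+ 2 * dot v v.
Proof.
move=> uv; have vu : dot v u = 0 by rewrite dot_sym uv sconj0.
rewrite dotDl !dotDr !dotZl !dotZr uv vu.
by rewrite !mulr0 addr0 add0r mulrA sqr_norm_sconj.
Qed.

Lemma cauchy_schwarz (x y : H) : `|dot x y| <= `|x| * `|y|.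
Proof.
have [->|y0] := eqVneq y 0.
  by rewrite linear0r !normr0 mulr0.
(* [a *: y] is the orthogonal projection of [x] onto the line of [y]; Pythagoras shows it is no
   longer than [x]. *)
pose a := dot x y / dot y y; pose w := x - a *: y.
have yy0 : dot y y != 0 by rewrite -Hnorm expf_neq0// normr_eq0.
have wy : dot w y = 0 by rewrite /w -scaleNr dotDl dotZl mulNr divfK// subrr.
have xE : dot x x = dot w w + `|a| ^+ 2 * dot y y.
  by rewrite -{1 2}(subrK (a *: y) x) pythagoras.
have yy : dot y y = `|y| ^+ 2 by rewrite Hnorm.
have : `|a| * `|y| <= `|x|.
  rewrite -(@ler_pXn2r _ 2) ?nnegrE ?mulr_ge0// Hnorm xE exprMn yy lerDr.
  by rewrite -Hnorm exprn_ge0.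
move=> /(ler_wpM2r (normr_ge0 y)); apply: le_trans.
by rewrite -mulrA -expr2 -yy -[dot x y](divfK yy0) normrM {2}yy normrX normr_id -yy.
Qed.

(** The vector [x] comes last so that, for fixed [n], this is a map that can carry a linear
    structure. *)
Definition partial_expansion (g h : nat -> H) (n : nat) (x : H) : H :=
  series (fun k => dot x (g k) *: h k) n.

Section PartialExpansion.
Variables (g h : nat -> H) (n : nat).

Lemma partial_expansion_linear : linear (partial_expansion g h n).
Proof.
move=> a x y; rewrite /partial_expansion /series /= scaler_sumr -big_split /=.
by apply: eq_bigr => k _; rewrite linearPl scalerDl scalerA.
Qed.

HB.instance Definition _ := GRing.isLinear.Build _ _ _ _
  (partial_expansion g h n) partial_expansion_linear.

Lemma partial_expansion_bounded : bounded_operator (partial_expansion g h n).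
Proof.
exists (\sum_(0 <= k < n) `|g k| * `|h k|) => x.
rewrite mulr_suml (le_trans (ler_norm_sum _ _ _))// ler_sum// => k _.
by rewrite normrZ mulrAC ler_wpM2r// mulrC cauchy_schwarz.
Qed.

End PartialExpansion.
End InnerProduct.

Theorem proposition2p6 (R : realType) (s : scalar_kind)
    (H : completeNormedModType (scalars R s)) (dot : {dot H for @sconj R s})
    (Hnorm : norm_induced dot) (f g : nat -> H)
    (Hrec : forall x : H,
        series (fun k => dot x (g k) *: f k) @ \oo --> x)
    (Hcvg : forall x : H,
        cvg (series (fun k => dot x (g k) *: f k.+1) @ \oo)) :
  (exists T : {linear H -> H}, bounded_operator T /\ orbit_of f T) <->
  (forall j : nat,
      series (fun k => dot (f j) (g k) *: f k.+1) @ \oo --> f j.+1).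
Proof.
split=> [[T [Tbnd fT]] j|fE].
  have contT := bounded_operator_continuous _ _ _ _ Tbnd.
  have TfS k : T (f k) = f k.+1 by rewrite fT [f k.+1]fT.
  rewrite -TfS.
  (* By linearity [T] sends the partial sums of the expansion of [f j] to the shifted ones;
     continuity then passes to the limit. *)
  have -> : series (fun k => dot (f j) (g k) *: f k.+1) =
            T \o series (fun k => dot (f j) (g k) *: f k).
    apply/funext => n; rewrite /series /= linear_sum.
    by apply: eq_bigr => k _; rewrite linearZ TfS.
  by apply: continuous_cvg (Hrec (f j)); exact: contT.
have contS n : continuous (partial_expansion dot g (f \o S) n).
  by apply: bounded_operator_continuous; exact: partial_expansion_bounded.
have [T Tbnd cvgT] := pointwise_limit_bounded_operator _ _ _ _
  (@scalars_archimedean R s) contS Hcvg.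
exists T; split=> // n.
(* At [f k] the same partial sums tend to both sides, and limits are unique. *)
have TfS k : T (f k) = f k.+1 by exact: cvg_unique (cvgT (f k)) (fE k).
by elim: n => //= n <-.
Qed.
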